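(* Let $k\ge 4$ be a positive integer that is not prime. Then $S_k=\langle 2k+1,2k+2,\dots,3k+1\rangle$ is not $\lambda$-minimal.
   Context: $\mathbb{N}=\{0,1,2,\dots\}$. A numerical set is a subset $T\subseteq\mathbb{N}$ with $0\in T$ and finite complement in $\mathbb{N}$. Its gaps are the elements of $\mathrm{G}(T)=\mathbb{N}\setminus T$; the largest gap is the Frobenius number $\mathrm{F}(T)$. A numerical semigroup is a numerical set closed under addition. $\langle n_1,\dots,n_t\rangle$ denotes the set of all linear combinations of $n_1,\dots,n_t$ with coefficients in $\mathbb{N}$. The enumeration $\lambda(T)$ of a numerical set $T$ is the integer partition whose Young diagram has as its profile (lower-right boundary) the lattice walk that, for $n=0,1,2,\dots,\mathrm{F}(T)$, takes a unit step right if $n\in T$ and a unit step up if $n\notin T$. Equivalently, the parts of $\lambda(T)$ are the numbers $\#\{u\in T: u<x\}$, one for each gap $x\in\mathrm{G}(T)$. The size $|\lambda|$ of a partition is the sum of its parts. The hook length of a box in the Young diagram of a partition $\lambda$ is the number of boxes to its right in the same row plus the number of boxes below it in the same column plus $1$; $\mathrm{H}(\lambda)$ is the set of all hook lengths of $\lambda$. For a numerical semigroup $S$, $\mathcal{P}(S)=\{\lambda:\mathrm{H}(\lambda)=\mathbb{N}\setminus S\}$; it is known that $\lambda(S)\in\mathcal{P}(S)$. $S$ is $\lambda$-minimal if $|\lambda(S)|\le|\lambda|$ for all $\lambda\in\mathcal{P}(S)$. *)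

(* Defs.v *)
From mathcomp Require Import all_boot finmap.
From mathcomp Require Import boolp classical_sets functions cardinality.

Set Implicit Arguments.
Unset Strict Implicit.
Unset Printing Implicit Defensive.

Local Open Scope fset_scope.
Local Open Scope classical_set_scope.
Local Open Scope nat_scope.

Record numericalSet := NumericalSet {
  ns_set :> set nat;
  ns_0 : ns_set 0;
  ns_cofinite : finite_set (~` ns_set) }.

Record numericalSemigroup := NumericalSemigroup {
  nsg_set :> numericalSet;
  nsg_add : forall m n, ns_set nsg_set m -> ns_set nsg_set n -> ns_set nsg_set (m + n) }.

Definition gaps (T : numericalSet) : set nat := ~` T.

(* The rows are listed from top to bottom. *)
Record intpart := IntPart {
  parts :> seq nat;
  parts_sorted : sorted geq parts;
  parts_pos : 0 \notin parts }.

Definition part_size (l : intpart) : nat := sumn l.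

(* Row i and column j are numbered from 0. *)
Definition in_diagram (l : intpart) (i j : nat) : bool :=
  (i < size l) && (j < nth 0 l i).

Definition arm (l : intpart) (i j : nat) : nat := nth 0 l i - j.+1.

Definition leg (l : intpart) (i j : nat) : nat :=
  count (fun p => j < p) (drop i.+1 l).

Definition hook_length (l : intpart) (i j : nat) : nat :=
  (arm l i j + leg l i j).+1.

Definition hooks (l : intpart) : set nat :=
  [set h | exists i j, in_diagram l i j /\ h = hook_length l i j].

(* In the profile walk, the step up at a gap x ends a row whose length is the
   number of steps right made before it. *)
Definition enum_row (T : numericalSet) (x : nat) : nat :=
  #|` fset_set (T `&` [set u | u < x]) |.

Definition enum_parts (T : numericalSet) : seq nat :=
  sort geq [seq enum_row T x | x <- fset_set (gaps T)].

Lemma enum_parts_sorted (T : numericalSet) : sorted geq (enum_parts T).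
Proof. by apply: sort_sorted => m n; exact: leq_total. Qed.

Lemma enum_parts_pos (T : numericalSet) : 0 \notin enum_parts T.
Proof.
rewrite mem_sort; apply/mapP => -[x]; rewrite in_fset_set; last exact: ns_cofinite.
rewrite inE => Tx /esym/eqP; rewrite cardfs_eq0 => /eqP T0.
have finI : finite_set (T `&` [set u | u < x]).
  by apply: (sub_finite_set _ (finite_II x)) => u [].
have : 0 \in fset_set (T `&` [set u | u < x]).
  rewrite in_fset_set // inE; split; first exact: ns_0.
  by case: x Tx {T0 finI} => // /(_ (ns_0 T)).
by rewrite T0 inE.
Qed.

Definition enumeration (T : numericalSet) : intpart :=
  IntPart (enum_parts_sorted T) (enum_parts_pos T).

Definition hook_partitions (S : numericalSemigroup) : set intpart :=
  [set l | hooks l = gaps S].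

Definition lambda_minimal (S : numericalSemigroup) : Prop :=
  forall l, hook_partitions S l -> part_size (enumeration S) <= part_size l.

Definition generated (s : seq nat) : set nat :=
  [set n | exists c : nat -> nat, n = \sum_(a <- s) c a * a].

Lemma generated_0 (s : seq nat) : generated s 0.
Proof. by exists (fun=> 0); rewrite big1. Qed.

Lemma generated_add (s : seq nat) (m n : nat) :
  generated s m -> generated s n -> generated s (m + n).
Proof.
move=> [c ->] [d ->]; exists (fun a => c a + d a).
by rewrite -big_split; apply: eq_bigr => a _; rewrite mulnDl.
Qed.

Lemma generated_mul (s : seq nat) (a q : nat) :
  uniq s -> a \in s -> generated s (q * a).
Proof.
move=> us sa; exists (fun b => if b == a then q else 0).
rewrite (bigD1_seq a) //= eqxx big1 ?addn0 // => b /negbTE ->.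
by rewrite mul0n.
Qed.

Definition Sk_gens (k : nat) : seq nat := index_iota (2 * k + 1) (3 * k + 2).

Lemma Sk_cofinite (k : nat) : finite_set (~` generated (Sk_gens k)).
Proof.
pose m := 2 * k + 1; apply: (sub_finite_set _ (finite_II (m * m))) => n /= nS.
rewrite ltnNge; apply/negP => le_mm_n; apply: nS.
have us : uniq (Sk_gens k) by exact: iota_uniq.
have m0 : 0 < m by rewrite /m addn1.
have ltr : n %% m < m by rewrite ltn_mod.
have leq : n %% m <= n %/ m.
  by apply: leq_trans (ltnW ltr) _; rewrite leq_divRL.
have -> : n = (n %/ m - n %% m) * m + n %% m * m.+1.
  by rewrite mulnS addnCA -mulnDl subnK // addnC -divn_eq.
have m_in : m \in Sk_gens k.
  by rewrite mem_index_iota leqnn /= /m -addnS leq_add // leq_mul.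
apply: generated_add; first exact: generated_mul.
case: (posnP k) => [k0|k_gt0].
  by move: ltr; rewrite /m k0 modn1 mul0n => _; exact: generated_0.
apply: generated_mul => //; rewrite mem_index_iota leqnSn /= /m.
by rewrite addn1 addn2 !ltnS ltn_mul2r k_gt0.
Qed.

Definition Sk_set (k : nat) : numericalSet :=
  NumericalSet (generated_0 (Sk_gens k)) (@Sk_cofinite k).

Definition Sk (k : nat) : numericalSemigroup :=
  @NumericalSemigroup (Sk_set k) (@generated_add (Sk_gens k)).

(* Main.v *)
Require Import Defs.
From mathcomp Require Import all_boot.
From mathcomp Require Import finmap zify.
From mathcomp Require Import boolp classical_sets functions cardinality.

(** A partition comes from a numerical set [T], and then its hook lengths are
    the [h] with [u + h] a gap for some [u] in [T] ([hooks_enumeration]): row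
    and column of a box correspond to a gap [x] and to an element [u < x], and
    arm and leg together count all the integers strictly between [u] and [x].
    So the task is to find a [T] whose differences gap minus element are the
    gaps of [S_k] and whose enumeration is smaller than that of [S_k].

    The gaps of [S_k] are [1..2k] and [3k+2..4k+1]. Write [k = a b] with
    [a, b >= 2] and let the gaps of [T] be [a..2k] together with the [b] numbers
    [3k+1+ja], [1 <= j <= b]; that is, [S_k] is enlarged by [1..a-1] and by the
    [3k+1+y] with [y] in [1..k] not divisible by [a].
    - Every gap of [S_k] is a difference: subtracting the elements [0..a-1] of
      [T] from the gaps [a..2k] gives [1..2k], and subtracting them from the
      gaps [3k+1+ja] gives [3k+2..4k+1].
    - No element [h] of [S_k] is one. Beyond [4k+1] there are no gaps at all.
      If [2k+1 <= h <= 3k+1] and [u + h] is a gap, it is one of the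
      [3k+1+ja]; then [u <= 2k] forces [u < a], and [u + h] is too small.
    This is [comb_gap_differences].

    The size of an enumeration depends only on the sum of the gaps and on their
    number ([part_size_enumeration]), whence
    [2 (|lambda(S_k)| - |lambda(T)|) = (a-1) (b-1) (2a(b-1) - b) > 0].
    The factors [a-1] and [b-1] show where compositeness of [k] enters. *)

Set Implicit Arguments.
Unset Strict Implicit.
Unset Printing Implicit Defensive.

Local Open Scope nat_scope.

(** * Hook lengths of the enumeration of a numerical set *)

Definition memb (T : numericalSet) : pred nat := fun n => `[< ns_set T n >].

Lemma gapP T x : reflect (~ ns_set T x) (~~ memb T x).
Proof. by rewrite /memb -asbool_neg; exact: asboolP. Qed.

Definition rank (T : numericalSet) (x : nat) : nat := count (memb T) (iota 0 x).

(** Row [i] of the diagram belongs to entry [i] of this list: the largest gap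
    gives the longest row. *)
Definition desc_gaps (T : numericalSet) : seq nat :=
  sort geq (fset_set (gaps T)).

(** The order of the list is left free: the size of the enumeration does not
    depend on it, and explicit gap lists are best written block by block. *)
Definition lists_gaps (T : numericalSet) (s : seq nat) : Prop :=
  uniq s /\ forall y, (y \in s) = ~~ memb T y.

Lemma lists_desc_gaps T : lists_gaps T (desc_gaps T).
Proof.
split; first by rewrite sort_uniq fset_uniq.
move=> y; rewrite mem_sort in_fset_set; last exact: ns_cofinite.
by apply/idP/gapP; rewrite inE.
Qed.

Lemma desc_gaps_sorted T : sorted gtn (desc_gaps T).
Proof.
rewrite gtn_sorted_uniq_geq; have [-> _] := lists_desc_gaps T.
by apply: sort_sorted => m n; exact: leq_total.
Qed.

Lemma enum_rowE T x : enum_row T x = rank T x.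
Proof.
have fin : finite_set (T `&` [set u | u < x])%classic.
  by apply: (sub_finite_set _ (finite_II x)) => u [].
rewrite /rank -size_filter; apply: perm_size; apply: uniq_perm.
- exact: fset_uniq.
- by rewrite filter_uniq ?iota_uniq.
move=> u; rewrite in_fset_set // mem_filter mem_iota /= add0n.
apply/idP/andP; rewrite inE => -[].
  by move=> Tu ux; split=> //; apply/asboolP.
by move=> /asboolP.
Qed.

Lemma rank_split T u x : u < x ->
  rank T x = rank T u + memb T u + count (memb T) (iota u.+1 (x - u.+1)).
Proof.
move=> ux; rewrite /rank -[in LHS](subnKC ux) iotaD count_cat.
by rewrite -addn1 iotaD count_cat /= addn0 !add0n.
Qed.

Lemma leq_rank T : {homo rank T : x y / x <= y}.
Proof.
move=> x y; rewrite leq_eqVlt => /predU1P[-> //|/(rank_split T) ->].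
by rewrite -addnA leq_addr.
Qed.

(** The rank is only weakly increasing, but it does separate an element from
    the gaps beyond it: [u] itself is counted in [rank T y]. Hence the column of
    [u] meets exactly the rows of the gaps larger than [u]. *)
Lemma ltn_rank_gap T u y : memb T u -> ~~ memb T y ->
  (rank T u < rank T y) = (u < y).
Proof.
move=> Tu Ty; case: (ltnP u y) => [uy|/(leq_rank T) yu]; last by rewrite ltnNge yu.
by rewrite (rank_split T uy) Tu addn1 leq_addr.
Qed.

(** Column [j] of the row of [x] belongs to the element [u] of rank [j]. *)
Lemma rank_onto T j x : j < rank T x -> exists2 u, u < x & memb T u /\ rank T u = j.
Proof.
elim: x => [//|x IHx]; rewrite (rank_split T (ltnSn x)) subnn /= addn0 => jx.
have [/IHx[u ux ?]|xj] := ltnP j (rank T x); first by exists u => //; exact: ltnW.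
by exists x => //; case: (memb T x) jx => /=; lia.
Qed.

Lemma enum_partsE T : enum_parts T = map (rank T) (desc_gaps T).
Proof.
apply: (@sorted_eq _ geq).
- by move=> y x z /= xy yz; exact: leq_trans yz xy.
- by move=> x y /= /andP[yx xy]; apply/eqP; rewrite eqn_leq xy yx.
- exact: enum_parts_sorted.
- rewrite sorted_map; apply: sub_sorted (desc_gaps_sorted T) => x y /=.
  by move=> /ltnW; exact: leq_rank.
rewrite perm_sort (eq_map (enum_rowE T)); apply: perm_map.
by rewrite perm_sym perm_sort.
Qed.

Lemma count_gaps_between T s m n : lists_gaps T s ->
  count (fun y => m <= y < n) s = count (predC (memb T)) (iota m (n - m)).
Proof.
move=> [us sE]; rewrite -!size_filter; apply/perm_size/uniq_perm.
- exact: filter_uniq.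
- by rewrite filter_uniq ?iota_uniq.
move=> y; rewrite !mem_filter sE mem_iota /= andbC; congr (_ && _); lia.
Qed.

Lemma drop_gtn_sorted (s : seq nat) i : sorted gtn s -> i < size s ->
  drop i.+1 s = [seq y <- s | y < nth 0 s i].
Proof.
have gtnT : transitive gtn by move=> y x z /= yx zy; exact: ltn_trans zy yx.
elim: s i => // z s IHs [|i] /=; rewrite (path_sortedE gtnT) => /andP[/allP zs ss] si.
  rewrite ltnn drop0; apply/esym/all_filterP/allP => y /zs //.
rewrite ltnS in si.
by rewrite ltnNge (ltnW (zs _ (mem_nth 0 si))) /= IHs.
Qed.

(** Between [u] and [x], the arm counts the elements of [T] and the leg counts
    the gaps, so that together with the box itself they add up to [x - u]. *)
Lemma hook_length_enumeration T i u (x := nth 0 (desc_gaps T) i) :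
  i < size (desc_gaps T) -> memb T u -> u < x ->
  hook_length (enumeration T) i (rank T u) = x - u.
Proof.
move=> si Tu ux; rewrite /hook_length.
have -> : arm (enumeration T) i (rank T u) = count (memb T) (iota u.+1 (x - u.+1)).
  rewrite /arm /= enum_partsE (nth_map 0) // -/x (rank_split T ux) Tu addn1.
  by rewrite addKn.
have -> : leg (enumeration T) i (rank T u)
        = count (predC (memb T)) (iota u.+1 (x - u.+1)).
  rewrite -(count_gaps_between _ _ (lists_desc_gaps T)) /leg /= enum_partsE.
  rewrite -map_drop count_map drop_gtn_sorted ?desc_gaps_sorted // count_filter.
  apply: eq_in_count => y; have [_ ->] := lists_desc_gaps T => Ty /=.
  by rewrite ltn_rank_gap.
by rewrite count_predC size_iota subnSK.
Qed.

Lemma hooks_enumeration T :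
  hooks (enumeration T) = [set h | exists2 u, ns_set T u & ~ ns_set T (u + h)]%classic.
Proof.
have [_ gapsE] := lists_desc_gaps T.
have sizeE : size (enumeration T) = size (desc_gaps T).
  by rewrite /= enum_partsE size_map.
apply/seteqP; split=> h.
  move=> [i [j [/andP[]]]]; rewrite sizeE => si.
  rewrite /= enum_partsE (nth_map 0) // => /rank_onto[u ux [Tu <-]] ->.
  rewrite -/(hook_length (enumeration T) i (rank T u)) hook_length_enumeration //.
  exists u; first exact/asboolP.
  by rewrite subnKC ?(ltnW ux) //; apply/gapP; rewrite -gapsE mem_nth.
move=> [u Tu nTuh]; have h0 : 0 < h by case: h nTuh => //; rewrite addn0.
have uh : u + h \in desc_gaps T by rewrite gapsE; apply/gapP.
exists (index (u + h) (desc_gaps T)), (rank T u).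
have si : index (u + h) (desc_gaps T) < size (desc_gaps T) by rewrite index_mem.
have Tu' : memb T u by apply/asboolP.
rewrite hook_length_enumeration ?nth_index ?addKn //; last by lia.
split=> //; rewrite /in_diagram sizeE si /= enum_partsE (nth_map 0) //.
by rewrite nth_index // ltn_rank_gap ?inE -?gapsE //; lia.
Qed.

(** * Size of the enumeration of a numerical set *)

(** Every unordered pair of distinct entries is counted once, at its larger
    entry. *)
Lemma sum_count_ltn (s : seq nat) : uniq s ->
  \sum_(x <- s) count (fun y => y < x) s = 'C(size s, 2).
Proof.
elim: s => [|z s IHs] /=; first by rewrite big_nil.
move=> /andP[zs us]; rewrite big_cons ltnn add0n big_split /= IHs // binS bin1.
rewrite addnA addnC; congr (_ + _).
have -> : \sum_(x <- s) (z < x) = count (fun x => z < x) s.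
  by elim: {zs us IHs} s => [|x s IHs]; rewrite ?big_nil // big_cons IHs.
rewrite -(count_predC (fun x => x < z) s); congr (_ + _).
apply: eq_in_count => x xs /=; rewrite -leqNgt ltn_neqAle.
by case: eqVneq zs => // ->; rewrite xs.
Qed.

(** The part of a gap [x] is [x] minus the number of gaps below [x]; summing
    over all gaps, the corrections count the pairs of gaps. *)
Lemma part_size_enumeration T s : lists_gaps T s ->
  part_size (enumeration T) + 'C(size s, 2) = sumn s.
Proof.
move=> sT; have [us sE] := sT; have [ud dE] := lists_desc_gaps T.
have perm_s : perm_eq (desc_gaps T) s.
  by apply: uniq_perm => // y; rewrite dE sE.
rewrite /part_size /= enum_partsE !sumnE big_map (perm_big _ perm_s) /=.
rewrite -(sum_count_ltn us) -big_split /=; apply: eq_bigr => x _.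
have := count_gaps_between 0 x sT; rewrite subn0 => ->.
by rewrite count_predC size_iota.
Qed.

Lemma finite_setC_notin (s : seq nat) :
  finite_set (~` [set x | x \notin s])%classic.
Proof.
apply: (sub_finite_set _ (finite_seq s)) => x /= /negP.
by rewrite negbK.
Qed.

Definition ns_of_gaps (s : seq nat) (s0 : 0 \notin s) : numericalSet :=
  @NumericalSet [set x | x \notin s]%classic s0 (finite_setC_notin s).

Lemma lists_ns_of_gaps (s : seq nat) (s0 : 0 \notin s) :
  uniq s -> lists_gaps (ns_of_gaps s0) s.
Proof.
move=> us; split=> // y; apply/idP/gapP => /=; last by move/negP; rewrite negbK.
by move=> ys /negP.
Qed.

(** * Gaps of the semigroup *)

(** Counting summands locates a combination: one summand keeps it in
    [2k+1..3k+1], and from two summands on it is at least [4k+2]. *)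
Lemma Sk_combination_bounds (k : nat) (c : nat -> nat)
    (C := \sum_(i <- Sk_gens k) c i) :
  C * (2 * k + 1) <= \sum_(i <- Sk_gens k) c i * i <= C * (3 * k + 1).
Proof.
rewrite /C !big_distrl /= /Sk_gens !big_nat; apply/andP.
by split; apply: leq_sum => i ik; rewrite leq_mul2l; apply/orP; right; lia.
Qed.

(** Sums of two generators fill [4k+2..6k+2], and translates of that block by
    the smallest generator overlap, so nothing beyond is missed. *)
Lemma Sk_memP k n : 0 < k ->
  ns_set (Sk k) n <-> n = 0 \/ 2 * k + 1 <= n <= 3 * k + 1 \/ 4 * k + 2 <= n.
Proof.
move=> k0; split=> [[c ->]|].
  have /andP[] := Sk_combination_bounds k c.
  case: (\sum_(i <- _) c i) => [|[|C]]; nia.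
have gen i : 2 * k + 1 <= i <= 3 * k + 1 -> ns_set (Sk k) i.
  move=> ik; rewrite -[i]mul1n; apply: generated_mul; first exact: iota_uniq.
  by rewrite mem_index_iota; lia.
move=> [->|[/gen //|]]; first exact: ns_0.
elim/ltn_ind: n => n IHn n4; have [n6|n6] := leqP n (6 * k + 2).
  rewrite -(@subnK (n./2) n); last by lia.
  by apply: nsg_add; apply: gen; lia.
rewrite -(@subnK (2 * k + 1) n); last by lia.
by apply: nsg_add; [apply: IHn|apply: gen]; lia.
Qed.

Definition Sk_gap_seq k : seq nat := iota 1 (2 * k) ++ iota (3 * k + 2) k.

Lemma lists_Sk_gap_seq k : 0 < k -> lists_gaps (Sk k) (Sk_gap_seq k).
Proof.
move=> k0; split.
  rewrite cat_uniq !iota_uniq andbT; apply/hasPn => x.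
  by rewrite !mem_iota; lia.
move=> x; rewrite mem_cat !mem_iota; apply/idP/gapP => [xk /(Sk_memP _ k0)|nx].
  by lia.
apply: contra_notT nx => nx; apply/(Sk_memP _ k0); lia.
Qed.

(** * The smaller competitor *)

(** The spacing of the teeth of this comb equals the length of the run [0..a-1]
    of elements before the first gap. That makes the differences from each
    tooth abut those from the next. *)
Definition comb_gaps a b : seq nat :=
  iota a (2 * (a * b) + 1 - a) ++ [seq 3 * (a * b) + 1 + j * a | j <- iota 1 b].

Lemma comb_gapsP a b x :
  reflect (a <= x <= 2 * (a * b) \/
           exists2 j, 1 <= j <= b & x = 3 * (a * b) + 1 + j * a)
          (x \in comb_gaps a b).
Proof.
rewrite mem_cat mem_iota; apply: (iffP orP) => -[xab|].
- by left; lia.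
- by case/mapP=> j; rewrite mem_iota => jb ->; right; exists j; lia.
- by left; lia.
- case=> j jb ->; right; apply: map_f; rewrite mem_iota; lia.
Qed.

Lemma comb_gaps_uniq a b : 0 < a -> uniq (comb_gaps a b).
Proof.
move=> a0; rewrite cat_uniq iota_uniq /= map_inj_in_uniq ?iota_uniq ?andbT.
  by apply/hasPn => _ /mapP[j _ ->]; rewrite mem_iota; nia.
by move=> i j _ _ /addnI/eqP; rewrite eqn_pmul2r // => /eqP.
Qed.

Lemma comb_gaps0 a b : 0 < a -> 0 \notin comb_gaps a b.
Proof. by move=> a0; apply/comb_gapsP => -[|[j]]; lia. Qed.

(** This puts the enumeration of the comb into the competition: its hook
    lengths are the gaps of the semigroup. The elements [0..a-1] already produce
    all of them, and a nonzero element of the semigroup added to an element of the comb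
    set either falls short of the first tooth or lies past the last one. *)
Lemma comb_gap_differences a b h : 0 < a -> 0 < b ->
  (exists2 u, u \notin comb_gaps a b & u + h \in comb_gaps a b) <->
  h \in Sk_gap_seq (a * b).
Proof.
move=> a0 b0; rewrite mem_cat !mem_iota; split.
  move=> [u /comb_gapsP nu /comb_gapsP uh].
  (* A difference in [2k+1..3k+1] would need u < a: no tooth is reached then. *)
  have ua : ~ (a <= u <= 2 * (a * b)) by move=> ?; apply: nu; left.
  case: uh => [|[j jb e]]; first by lia.
  have : j * a <= a * b by rewrite mulnC leq_mul2l; lia.
  have : a <= j * a by rewrite leq_pmull; lia.
  have [h0|] := posnP h; last by lia.
  by exfalso; apply: nu; right; exists j; lia.
have small u : u < a -> u \notin comb_gaps a b.
  by move=> ua; apply/comb_gapsP => -[|[j _]]; nia.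
have [hk|hk] := leqP h (2 * (a * b)) => hgap.
  exists (a - h); first by apply: small; lia.
  by apply/comb_gapsP; left; nia.
(* The tooth to use is the first one at or above h, and u its distance to h. *)
have [y hE yk] : exists2 y, h = 3 * (a * b) + 1 + y.+1 & y < a * b.
  by exists (h - (3 * (a * b) + 2)); lia.
have ya := divn_eq y a; have ra : y %% a < a by rewrite ltn_mod.
exists (a - (y %% a).+1); first by apply: small; lia.
apply/comb_gapsP; right; exists (y %/ a).+1; last by lia.
by rewrite /= ltn_divLR // mulnC.
Qed.

Lemma double_bin2 n : 2 * 'C(n, 2) + n = n * n.
Proof. by rewrite -mul_bin_diag bin1; case: n => //= n; rewrite -mulnSr. Qed.

Lemma sumn_iota m n : sumn (iota m n) = n * m + 'C(n, 2).
Proof.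
elim: n m => [|n IHn] m //=; rewrite IHn binS bin1; lia.
Qed.

Lemma sumn_comb_gaps a b : sumn (comb_gaps a b)
  = (2 * (a * b) + 1 - a) * a + 'C(2 * (a * b) + 1 - a, 2)
    + (b * (3 * (a * b) + 1) + (b + 'C(b, 2)) * a).
Proof.
have sumn_affine c s : sumn [seq c + j * a | j <- s] = size s * c + sumn s * a.
  by elim: s => //= j s ->; lia.
by rewrite sumn_cat sumn_iota sumn_affine size_iota sumn_iota muln1.
Qed.

Lemma part_size_comb_lt a b (a1 : 1 < a) : 1 < b ->
  part_size (enumeration (ns_of_gaps (comb_gaps0 b (ltnW a1))))
    < part_size (enumeration (Sk (a * b))).
Proof.
move=> b1; have k0 : 0 < a * b by nia.
have := part_size_enumeration (lists_Sk_gap_seq k0).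
have := part_size_enumeration
  (lists_ns_of_gaps (comb_gaps0 b (ltnW a1)) (comb_gaps_uniq b (ltnW a1))).
rewrite sumn_comb_gaps sumn_cat !sumn_iota !size_cat size_map !size_iota.
have := double_bin2 b; have := double_bin2 (2 * (a * b) + 1 - a).
have := double_bin2 (2 * (a * b) + 1 - a + b).
have := double_bin2 (2 * (a * b)); have := double_bin2 (a * b).
have := double_bin2 (2 * (a * b) + a * b).
do 6 move: 'C(_, _) => ?.
do 2 move: (part_size _) => ?.
(* Substituting c = a - 2 and d = b - 2 removes the truncated subtraction and
   leaves a polynomial inequality with only positive coefficients. *)
have [c aE] : exists c, a = c + 2 by exists (a - 2); lia.
have [d bE] : exists d, b = d + 2 by exists (b - 2); lia.
have -> : 2 * (a * b) + 1 - a = 2 * (c * d) + 3 * c + 4 * d + 7 by lia.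
rewrite {}aE {}bE; lia.
Qed.

Theorem theorem1p4 (k : nat) (hk : 4 <= k) (hp : ~~ prime k) :
  ~ lambda_minimal (Sk k).
Proof.
have [a [b [a1 b1 kE]]] : exists a b, [/\ 1 < a, 1 < b & k = a * b].
  case/primePn: hp => [|[a /andP[a1 ak] /dvdnP[b kE]]]; first by lia.
  by exists a, b; split=> //; nia.
rewrite {}kE in hk *.
move=> /(_ (enumeration (ns_of_gaps (comb_gaps0 b (ltnW a1))))).
rewrite leqNgt part_size_comb_lt // => /(_ _)/negP; apply=> //.
rewrite /hook_partitions /= hooks_enumeration; apply/seteqP.
have [_ SE] := @lists_Sk_gap_seq (a * b) (ltac:(lia)).
split=> h.
  move=> [u /= nu /negP]; rewrite negbK => uh; apply/gapP; rewrite -SE.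
  by apply/comb_gap_differences; [lia|lia|exists u].
move=> /gapP; rewrite -SE => /comb_gap_differences[]; [lia|lia|].
by move=> u nu uh; exists u => //=; apply/negP; rewrite negbK.
Qed.
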